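(* Let $D$ be an integral domain, let $*$ be a star operation of finite type on $D$ and let $I$ be a $*$-invertible valuation ideal of $D$. Then $I_*$ is a $*$-invertible valuation $*$-ideal of $D$ (that is, $I_*$ is a $*$-ideal which is $*$-invertible and is a valuation ideal).
   Context: Let $D$ be an integral domain with quotient field $K$. An overring of $D$ is a subring of $K$ containing $D$. $F(D)$ (resp. $f(D)$) is the set of nonzero fractional (resp. nonzero finitely generated fractional) ideals of $D$; for $A\in F(D)$, $A^{-1}=\{x\in K\mid xA\subseteq D\}$. A star operation on $D$ is a map $*:F(D)\to F(D)$, $A\mapsto A_*$, such that for all $A,B\in F(D)$ and nonzero $c\in K$: $A\subseteq A_*=(A_* )_*$; $A\subseteq B$ implies $A_*\subseteq B_*$; $(cA)_*=cA_*$; $D_*=D$. It is of finite type if $A_*=\bigcup_{C\in f(D),\,C\subseteq A}C_*$ for all $A\in F(D)$. A $*$-ideal is an $I\in F(D)$ with $I\subseteq D$ and $I_*=I$. $I\in F(D)$ is $*$-invertible if $(II^{-1})_*=D$. An ideal $I$ of $D$ is a valuation ideal if there is a valuation overring $V$ of $D$ with $IV\cap D=I$. *)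

(* Defs.v *)
From HB Require Import structures.
From mathcomp Require Import all_boot all_algebra.
From mathcomp Require Import boolp classical_sets.

Set Implicit Arguments.
Unset Strict Implicit.
Unset Printing Implicit Defensive.

Import GRing.Theory.
Local Open Scope classical_set_scope.
Local Open Scope ring_scope.

Section StarOperations.
Variable D : idomainType.
Notation K := {fraction D}.
Implicit Types (A B C I V : set K) (star : set K -> set K).

(* D is identified with its image in K. *)
Definition base_ring : set K := range (@tofrac D).

Definition is_submodule A : Prop :=
  GRing.zmod_closed (mem A) /\ forall (d : D) x, A x -> A (tofrac d * x).

Definition frac_ideal A : Prop :=
  [/\ is_submodule A,
      exists2 x, A x & x != 0
    & exists2 d : D, d != 0 & forall x, A x -> base_ring (tofrac d * x)].

Definition lin_span n (g : 'I_n -> K) : set K :=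
  [set \sum_(i < n) tofrac (c i) * g i | c in [set: 'I_n -> D]].

Definition fg_frac_ideal A : Prop :=
  frac_ideal A /\ exists n (g : 'I_n -> K), A = lin_span g.

Definition scale_set (c : K) A : set K := [set c * x | x in A].

(* Finite sums of products, so that I V is the extension of I to an overring V
   and I I^-1 is the product of fractional ideals. *)
Definition prod_set A B : set K :=
  [set x | exists n (a b : 'I_n -> K),
     [/\ forall i, A (a i), forall i, B (b i) & x = \sum_(i < n) a i * b i]].

Definition inv_ideal A : set K := [set x | scale_set x A `<=` base_ring].

(* A star operation is a map F(D) -> F(D); it is represented by a function on
   all subsets of K, of which only the values on F(D) are ever constrained. *)
Definition star_operation star : Prop :=
  [/\ forall A, frac_ideal A -> frac_ideal (star A),
      forall A, frac_ideal A -> A `<=` star A /\ star (star A) = star A,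
      forall A B, frac_ideal A -> frac_ideal B -> A `<=` B -> star A `<=` star B,
      forall A (c : K), frac_ideal A -> c != 0 ->
        star (scale_set c A) = scale_set c (star A)
    & star base_ring = base_ring].

Definition finite_type star : Prop :=
  forall A, frac_ideal A ->
    star A = \bigcup_(C in [set C | fg_frac_ideal C /\ C `<=` A]) star C.

Definition star_ideal star I : Prop :=
  [/\ frac_ideal I, I `<=` base_ring & star I = I].

Definition star_invertible star I : Prop :=
  frac_ideal I /\ star (prod_set I (inv_ideal I)) = base_ring.

Definition overring V : Prop :=
  GRing.subring_closed (mem V) /\ base_ring `<=` V.

(* K is also the quotient field of every overring of D, so an overring is a
   valuation domain iff it contains x or x^-1 for every nonzero x in K. *)
Definition valuation_overring V : Prop :=
  overring V /\ forall x : K, x != 0 -> V x \/ V x^-1.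

Definition integral_ideal I : Prop := is_submodule I /\ I `<=` base_ring.

Definition valuation_ideal I : Prop :=
  integral_ideal I /\
  exists2 V, valuation_overring V & prod_set I V `&` base_ring = I.

End StarOperations.

(* Main.v *)
Require Import Defs.
From mathcomp Require Import all_boot all_algebra.
From mathcomp Require Import boolp classical_sets.

(** The valuation overring [V] that exhibits [I] as a valuation ideal also
    exhibits its closure [I_*] as one: the contraction [I V \cap D = I] passes to
    the closure ([closure_contraction]).  Multiplication by an element [c] of
    [I I^-1] carries [I_*] into [I], because [I_* I^-1] is still contained in [D]
    ([mul_prod_inv_closure]).  Hence for [x] in [I_* V] and in [D] the
    product [c * x] lies in [I V] and in [D], that is, in [I].  So [x (I I^-1)]
    is contained in [I]; taking closures, and using that [I I^-1] has closure
    [D], gives [x D \subseteq I_*].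

    That [I_*] is invertible comes from the fact that it has the same inverse
    as [I] ([inv_ideal_star]). *)

Set Implicit Arguments.
Unset Strict Implicit.
Unset Printing Implicit Defensive.

Import GRing.Theory.
Local Open Scope classical_set_scope.
Local Open Scope ring_scope.

(** * Submodules and fractional ideals *)

Lemma submodule_intro (D : idomainType) (A : set {fraction D}) :
  A 0 -> (forall x y, A x -> A y -> A (x - y)) ->
  (forall (d : D) x, A x -> A (tofrac d * x)) -> is_submodule A.
Proof.
move=> A0 AB AZ; split=> //; split; first exact: mem_set.
by move=> x y /set_mem Ax /set_mem Ay; apply: mem_set; apply: AB.
Qed.

Lemma submodule0 (D : idomainType) (A : set {fraction D}) :
  is_submodule A -> A 0.
Proof. by case=> -[/set_mem]. Qed.

Lemma submoduleB (D : idomainType) (A : set {fraction D}) x y :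
  is_submodule A -> A x -> A y -> A (x - y).
Proof.
by case=> -[_ AB] _ Ax Ay; apply: set_mem; apply: AB; apply: mem_set.
Qed.

Lemma submoduleD (D : idomainType) (A : set {fraction D}) x y :
  is_submodule A -> A x -> A y -> A (x + y).
Proof.
move=> sA Ax Ay; rewrite -[y]opprK -[- y]sub0r.
by apply: submoduleB => //; apply: submoduleB => //; apply: submodule0.
Qed.

Lemma submoduleZ (D : idomainType) (A : set {fraction D}) r x :
  is_submodule A -> base_ring r -> A x -> A (r * x).
Proof. by case=> _ AZ [d _ <-]; apply: AZ. Qed.

Lemma base_ring1 (D : idomainType) : @base_ring D 1.
Proof. by exists 1; rewrite // tofrac1. Qed.

Lemma base_ring_submodule (D : idomainType) : is_submodule (@base_ring D).
Proof.
apply: submodule_intro.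
- by exists 0; rewrite // tofrac0.
- by move=> _ _ [a _ <-] [b _ <-]; exists (a - b); rewrite // tofracB.
- by move=> d _ [a _ <-]; exists (d * a); rewrite // tofracM.
Qed.

Lemma integral_frac_ideal (D : idomainType) (A : set {fraction D}) :
  is_submodule A -> A `<=` @base_ring D -> (exists2 x, A x & x != 0) ->
  frac_ideal A.
Proof.
move=> sA AD An0; split=> //; exists 1; first exact: oner_neq0.
by move=> x Ax; rewrite tofrac1 mul1r; apply: AD.
Qed.

Lemma base_ring_frac_ideal (D : idomainType) : frac_ideal (@base_ring D).
Proof.
apply: integral_frac_ideal => //; first exact: base_ring_submodule.
by exists 1; [exact: base_ring1 | exact: oner_neq0].
Qed.

Lemma scale_set_frac_ideal (D : idomainType) (c : {fraction D}) A :
  frac_ideal A -> c != 0 -> scale_set c A `<=` @base_ring D ->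
  frac_ideal (scale_set c A).
Proof.
move=> [sA [a Aa a0] _] c0 cAD; apply: integral_frac_ideal => //.
- apply: submodule_intro.
  + by exists 0; [exact: submodule0 | rewrite mulr0].
  + move=> _ _ [x Ax <-] [y Ay <-]; exists (x - y); last by rewrite mulrBr.
    exact: submoduleB.
  + move=> d _ [x Ax <-]; exists (tofrac d * x); last by rewrite mulrCA.
    by case: sA => _; apply.
- by exists (c * a); [exists a | rewrite mulf_neq0].
Qed.

Lemma inv_ideal_submodule (D : idomainType) (A : set {fraction D}) :
  is_submodule (inv_ideal A).
Proof.
have sD := base_ring_submodule D.
apply: submodule_intro.
- by move=> _ [a Aa <-]; rewrite mul0r; apply: submodule0.
- move=> x y xA yA _ [a Aa <-]; rewrite mulrBl.
  by apply: submoduleB => //; [apply: xA | apply: yA]; exists a.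
- move=> d x xA _ [a Aa <-]; rewrite -mulrA.
  by apply: submoduleZ => //; [exists d | apply: xA; exists a].
Qed.

(** * Products of sets *)

(** Membership of a product set is used through this induction principle, which
    hides the indexing of the sums. *)
Lemma prod_set_ind (D : idomainType) (A B : set {fraction D})
    (P : {fraction D} -> Prop) :
  P 0 -> (forall x y, P x -> P y -> P (x + y)) ->
  (forall a b, A a -> B b -> P (a * b)) ->
  forall x, prod_set A B x -> P x.
Proof.
move=> P0 PD PM _ [n [a [b [Aa Bb ->]]]].
by apply: (big_ind P) => // i _; apply: PM.
Qed.

Lemma prod_set_mul (D : idomainType) (A B : set {fraction D}) a b :
  A a -> B b -> prod_set A B (a * b).
Proof.
move=> Aa Bb; exists 1, (fun=> a), (fun=> b).
by split=> //; rewrite big_ord1.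
Qed.

Lemma prod_set0 (D : idomainType) (A B : set {fraction D}) : prod_set A B 0.
Proof.
by exists 0, (fun=> 0), (fun=> 0); split; [case | case | rewrite big_ord0].
Qed.

Lemma prod_setD (D : idomainType) (A B : set {fraction D}) x y :
  prod_set A B x -> prod_set A B y -> prod_set A B (x + y).
Proof.
move=> [n [a [b [Aa Bb ->]]]] [m [a' [b' [Aa' Bb' ->]]]].
pose glue (f : 'I_n -> {fraction D}) (f' : 'I_m -> {fraction D}) i :=
  match split i with inl j => f j | inr j => f' j end.
exists (n + m)%N, (glue a a'), (glue b b'); split.
- by move=> i; rewrite /glue; case: split.
- by move=> i; rewrite /glue; case: split.
- rewrite big_split_ord /glue; congr (_ + _); apply: eq_bigr => i _.
    by rewrite -[lshift m i]/(unsplit (inl i)) unsplitK.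
  by rewrite -[rshift n i]/(unsplit (inr i)) unsplitK.
Qed.

Lemma prod_set_mulr (D : idomainType) (A B : set {fraction D}) c x :
  (forall b, B b -> B (b * c)) -> prod_set A B x -> prod_set A B (x * c).
Proof.
move=> BM; move: x; apply: prod_set_ind.
- by rewrite mul0r; apply: prod_set0.
- by move=> x y Px Py; rewrite mulrDl; apply: prod_setD.
- by move=> a b Aa Bb; rewrite -mulrA; apply: prod_set_mul => //; apply: BM.
Qed.

Lemma prod_set_submodule (D : idomainType) (A B : set {fraction D}) :
  is_submodule B -> is_submodule (prod_set A B).
Proof.
move=> sB.
have PZ (d : D) x : prod_set A B x -> prod_set A B (tofrac d * x).
  move=> ABx; rewrite mulrC; apply: prod_set_mulr => // b Bb.
  by rewrite mulrC; case: sB => _; apply.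
apply: submodule_intro => //; first exact: prod_set0.
move=> x y Px Py; apply: prod_setD => //.
by rewrite -[y]mul1r -mulNr -tofrac1 -tofracN; apply: PZ.
Qed.

Lemma prod_inv_ideal_sub (D : idomainType) (A B : set {fraction D}) :
  B `<=` inv_ideal A -> prod_set A B `<=` @base_ring D.
Proof.
have sD := base_ring_submodule D.
move=> BA; apply: prod_set_ind; first exact: submodule0.
  by move=> x y; apply: submoduleD.
by move=> a b Aa /BA bA; rewrite mulrC; apply: bA; exists a.
Qed.

Lemma prod_inv_frac_ideal (D : idomainType) (A : set {fraction D}) :
  frac_ideal A -> frac_ideal (prod_set A (inv_ideal A)).
Proof.
move=> [sA [a Aa a0] [d d0 dA]]; apply: integral_frac_ideal.
- by apply: prod_set_submodule; apply: inv_ideal_submodule.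
- exact: prod_inv_ideal_sub.
- exists (a * tofrac d); last by rewrite mulf_neq0 // tofrac_eq0.
  by apply: prod_set_mul => // _ [x Ax <-]; apply: dA.
Qed.

(** * Star closures *)

Lemma star_sub_base (D : idomainType) (star : set {fraction D} -> _) A :
  star_operation star -> frac_ideal A -> A `<=` @base_ring D ->
  star A `<=` @base_ring D.
Proof.
case=> _ _ mono _ starD fA AD; rewrite -starD.
by apply: mono => //; apply: base_ring_frac_ideal.
Qed.

(** Compatibility with scaling: if [x A] is contained in [D], then so
    is [x A_* = (x A)_*]. *)
Lemma inv_ideal_star (D : idomainType) (star : set {fraction D} -> _) A :
  star_operation star -> frac_ideal A -> inv_ideal (star A) = inv_ideal A.
Proof.
move=> st fA; have [_ ext _ scale _] := st.
have [Asub _] := ext _ fA.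
rewrite eqEsubset; split=> [x xA _ [a /Asub Aa <-]|x xA].
  by apply: xA; exists a.
have [->|x0] := eqVneq x 0.
  by move=> _ [a _ <-]; rewrite mul0r; exists 0; rewrite ?tofrac0.
rewrite /inv_ideal /= -scale //; apply: star_sub_base => //.
exact: scale_set_frac_ideal.
Qed.

Lemma star_invertible_star (D : idomainType) (star : set {fraction D} -> _) I :
  star_operation star -> star_invertible star I ->
  star_invertible star (star I).
Proof.
move=> st [fI invI]; have [fst ext mono _ _] := st.
have fP := prod_inv_frac_ideal (fst _ fI).
split; first exact: fst.
rewrite eqEsubset; split.
  by apply: star_sub_base => //; apply: prod_inv_ideal_sub.
rewrite -[X in X `<=` _]invI.
apply: mono => //; first exact: prod_inv_frac_ideal.
rewrite inv_ideal_star //; apply: prod_set_ind; first exact: prod_set0.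
  by move=> x y; apply: prod_setD.
move=> a b Ia Ib; apply: prod_set_mul => //.
by have [Isub _] := ext _ fI; apply: Isub.
Qed.

(** If [u = \sum a_k * b_k] with [a_k] in [I] and [b_k] in [I^-1], then
    [u * y = \sum a_k * (b_k * y)], and each [b_k * y] is in [D] because
    [I^-1] is also the inverse of the closure. *)
Lemma mul_prod_inv_closure (D : idomainType)
    (star : set {fraction D} -> _) I u y :
  star_operation star -> frac_ideal I ->
  prod_set I (inv_ideal I) u -> star I y -> I (u * y).
Proof.
move=> st fI Pu Iy; have [sI _ _] := fI.
move: u Pu; apply: prod_set_ind.
- by rewrite mul0r; apply: submodule0.
- by move=> x z Ix Iz; rewrite mulrDl; apply: submoduleD.
- move=> a b Ia; rewrite -(inv_ideal_star st fI) => bI.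
  by rewrite -mulrA mulrC; apply: submoduleZ => //; apply: bI; exists y.
Qed.

(** With [P = I I^-1], each [c * x] for [c] in [P] lies in [I], so [x] belongs to
    [x P_* = (x P)_*], which is contained in [I_*]. *)
Lemma closure_contraction (D : idomainType) (star : set {fraction D} -> _)
    I V :
  star_operation star -> star_invertible star I ->
  prod_set I V `&` @base_ring D = I ->
  prod_set (star I) V `&` @base_ring D `<=` star I.
Proof.
move=> st [fI invI] IV x [Px Dx].
have [fst ext mono scale _] := st.
have [Isub _] := ext _ fI; have [sI _ _] := fst _ fI.
have fP := prod_inv_frac_ideal fI.
have [->|x0] := eqVneq x 0; first exact: submodule0.
have xPI : scale_set x (prod_set I (inv_ideal I)) `<=` I.
  move=> _ [c Pc <-]; rewrite -IV; split; last first.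
    rewrite mulrC; apply: submoduleZ => //; first exact: base_ring_submodule.
    exact: (prod_inv_ideal_sub _ Pc).
  rewrite mulrC; move: x Px {Dx x0}; apply: prod_set_ind.
  - by rewrite mulr0; apply: prod_set0.
  - by move=> x y Px Py; rewrite mulrDr; apply: prod_setD.
  - move=> y v Iy Vv; rewrite mulrA; apply: prod_set_mul => //.
    exact: (mul_prod_inv_closure st).
have fxP : frac_ideal (scale_set x (prod_set I (inv_ideal I))).
  by apply: scale_set_frac_ideal => // y /xPI; rewrite -IV => -[].
apply: (mono _ _ fxP fI xPI); rewrite scale // invI.
by exists 1; [exact: base_ring1 | rewrite mulr1].
Qed.

Theorem lemma3p2 (D : idomainType)
    (star : set {fraction D} -> set {fraction D}) (I : set {fraction D}) :
  star_operation star -> finite_type star ->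
  star_invertible star I -> valuation_ideal I ->
  [/\ star_ideal star (star I), star_invertible star (star I)
    & valuation_ideal (star I)].
Proof.
move=> st _ invI [[sI ID] [V vV IV]].
have [fI _] := invI; have [[_ DV] _] := vV.
have [fst ext _ _ _] := st; have [_ starI] := ext _ fI.
have fsI := fst _ fI; have sID := star_sub_base st fI ID.
split; [by split | exact: star_invertible_star |].
split; first by split=> //; case: fsI.
exists V => //; rewrite eqEsubset; split=> [|x Ix].
  exact: closure_contraction.
split; last exact: sID.
rewrite -[x]mulr1; apply: prod_set_mul => //.
by apply: DV; apply: base_ring1.
Qed.
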